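(* Let $g(q)\in\mathbb Z[q]$. There exists a functor $\overline\Lambda^{g(q)}$ from the category of $\mathbb Z[q]$-algebras to the category of (not necessarily unital) commutative rings such that: (1) for every $\mathbb Z[q]$-algebra $A$, the underlying set of $\overline\Lambda^{g(q)}(A)$ is $\{1+\sum_{n\ge1}a_nt^n: a_n\in A\}$; (2) for every $\mathbb Z[q]$-algebra homomorphism $f:A\to B$, $\overline\Lambda^{g(q)}(f)(1+\sum_{n\ge1}a_nt^n)=1+\sum_{n\ge1}f(a_n)t^n$; (3) for every $\mathbb Z[q]$-algebra $A$, the map $$\overline\Upsilon^{g(q)}_A:\overline\Lambda^{g(q)}(A)\to\mathrm{Gh}(A),\qquad \prod_{n\ge1}\frac{1}{1-a_nt^n}\mapsto \frac{d}{dt}\log\prod_{n\ge1}\frac{1-g(q)a_nt^n}{1-a_nt^n}$$ is a ring homomorphism. Furthermore, if $g(q)\neq1$, then $\overline\Lambda^{g(q)}$ is uniquely determined by (1)–(3).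
   Context: A $\mathbb Z[q]$-algebra is a commutative ring with unity with a unital homomorphism from $\mathbb Z[q]$; morphisms are unity-preserving $\mathbb Z[q]$-algebra homomorphisms. Every power series $1+\sum_{n\ge1}c_nt^n\in A[[t]]$ can be written uniquely as $\prod_{n\ge1}(1-a_nt^n)^{-1}$ with $a_n\in A$. $\mathrm{Gh}(A)$ denotes the ring of formal series $\sum_{n\ge1}c_nt^{n-1}$ with $c_n\in A$, with coefficientwise addition and coefficientwise multiplication ($\sum c_nt^{n-1}\cdot\sum d_nt^{n-1}=\sum c_nd_nt^{n-1}$). *)

(* Defs.v *)
From HB Require Import structures.
From mathcomp Require Import all_boot all_order all_algebra.
Set Implicit Arguments. Unset Strict Implicit. Unset Printing Implicit Defensive.
Import GRing.Theory.
Local Open Scope ring_scope.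

(* Z[q]-algebras are modelled as pairs (A : comPzRingType, qA : A), where qA is
   the image of q; a Z[q]-algebra morphism is an f : {rmorphism A -> B} with
   f qA = qB.  (comPzRingType allows the zero ring.) *)

Section Series.
Variable A : comPzRingType.

Definition series := nat -> A.

Definition sone : series := fun k => if k == 0%N then 1 else 0.
Definition smul (s1 s2 : series) : series :=
  fun k => \sum_(i < k.+1) s1 i * s2 (k - i)%N.
Definition sexp (s : series) (j : nat) : series := iter j (smul s) sone.

Definition sprod (N : nat) (F : nat -> series) : series :=
  \big[smul/sone]_(1 <= n < N.+1) F n.
(* infinite product prod_{n>=1} F n, for factors with F n = 1 + O(t^n):
   the coefficient of t^k only depends on the factors with n <= k *)
Definition sinfprod (F : nat -> series) : series := fun k => sprod k F k.

Definition lin (x : A) (n : nat) : series :=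
  fun k => if k == 0%N then 1 else if k == n then - x else 0.
(* 1/(1 - x t^n) = sum_j x^j t^(n j)   (n >= 1) *)
Definition geom (x : A) (n : nat) : series :=
  fun k => if (n %| k)%N then x ^+ (k %/ n) else 0.

(* inverse of a series with constant term 1: sum_j (1 - s)^j *)
Definition sinv (s : series) : series :=
  fun k => \sum_(j < k.+1) sexp (fun i => sone i - s i) j k.
Definition sderiv (s : series) : series := fun k => s k.+1 *+ k.+1.
Definition dlog (s : series) : series := smul (sderiv s) (sinv s).

(* Elements 1 + sum_{n>=1} a_n t^n of Lambda(A) are represented by their
   tail x : nat -> A, x k = coefficient of t^(k+1). *)
Definition toser (x : nat -> A) : series :=
  fun k => if k is k'.+1 then x k' else 1.

(* The unique a_1, a_2, ... with c = prod_{n>=1} 1/(1 - a_n t^n)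
   (for c with constant term 1), computed recursively:
   wittseq c m = [:: a_1; ...; a_m]. *)
Fixpoint wittseq (c : series) (m : nat) : seq A :=
  if m is m'.+1 then
    let w := wittseq c m' in
    rcons w (c m - sprod m' (fun n => geom (nth 0 w n.-1) n) m)
  else [::].
Definition witt (c : series) (n : nat) : A := nth 0 (wittseq c n) n.-1.

Definition gval (g : {poly int}) (qA : A) : A :=
  \sum_(i < size g) (g`_i)%:~R * qA ^+ i.

(* Upsilon^{g(q)}_A : prod 1/(1-a_n t^n) |->
   d/dt log prod (1 - g(q) a_n t^n)/(1 - a_n t^n), valued in Gh(A),
   where an element sum_{n>=1} c_n t^(n-1) of Gh(A) is the series k |-> c_{k+1}. *)
Definition Upsilon (g : {poly int}) (qA : A) (x : nat -> A) : series :=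
  let a := witt (toser x) in
  dlog (sinfprod (fun n => smul (lin (gval g qA * a n) n) (geom (a n) n))).

End Series.

Record rngops (T : Type) := RngOps {
  radd : T -> T -> T;
  rmul : T -> T -> T;
  rzero : T;
  ropp : T -> T }.

Definition comrng_axioms (T : Type) (o : rngops T) : Prop :=
  (forall x y z, radd o x (radd o y z) = radd o (radd o x y) z) /\
  (forall x y, radd o x y = radd o y x) /\
  (forall x, radd o (rzero o) x = x) /\
  (forall x, radd o (ropp o x) x = rzero o) /\
  (forall x y z, rmul o x (rmul o y z) = rmul o (rmul o x y) z) /\
  (forall x y, rmul o x y = rmul o y x) /\
  (forall x y z, rmul o (radd o x y) z = radd o (rmul o x z) (rmul o y z)).

(* A candidate functor Lambda-bar^{g(q)}: for each Z[q]-algebra (A, qA) a ring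
   structure on the set {1 + sum_{n>=1} a_n t^n} (condition (1)). *)
Definition lamfun := forall (A : comPzRingType), A -> rngops (nat -> A).

Definition is_lambda_bar (g : {poly int}) (F : lamfun) : Prop :=
  (forall (A : comPzRingType) (qA : A), comrng_axioms (F A qA)) /\
  (forall (A B : comPzRingType) (qA : A) (qB : B) (f : {rmorphism A -> B}),
     f qA = qB ->
     forall x y : nat -> A,
       (fun k => f (radd (F A qA) x y k)) = radd (F B qB) (f \o x) (f \o y) /\
       (fun k => f (rmul (F A qA) x y k)) = rmul (F B qB) (f \o x) (f \o y)) /\
  (forall (A : comPzRingType) (qA : A) (x y : nat -> A) (k : nat),
     Upsilon g qA (radd (F A qA) x y) k = Upsilon g qA x k + Upsilon g qA y k /\
     Upsilon g qA (rmul (F A qA) x y) k = Upsilon g qA x k * Upsilon g qA y k).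

(* Main.v *)
(** Write a_n for the coordinates of a series in prod 1/(1 - a_n t^n) and r for
    g(q). The k-th coefficient of Upsilon is
    sum_(n | k) n (a_n^(k/n) - (r a_n)^(k/n)), which only involves r, so existence
    may be proved for g = q alone, the ring operations for general g being those
    of the algebra in which q acts as g(q).

    Every factor (1 - r a_n t^n)/(1 - a_n t^n) is congruent to 1 modulo 1 - r, and
    conversely every series congruent to 1 modulo 1 - r is a product of such
    factors: a_n is read off the first nontrivial coefficient. Hence the image of
    Upsilon consists of the logarithmic derivatives of the series congruent to
    1 modulo 1 - r, a class of series that contains products, inverses and,
    by Witt's formula for the product of 1/(1 - u t^d) and 1/(1 - v t^e), the
    series whose logarithmic derivatives are the products of ghost vectors.
    This is used over the free algebra Z[q][X_0, X_1, ...] only: the resulting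
    universal coefficients define the operations over every algebra. In the free
    algebra, n (1 - g(q)) is a nonzerodivisor when g <> 1, so Upsilon is injective;
    this gives the ring axioms and uniqueness there, and both pass to every
    algebra because its sequences lift to the free algebra. *)
From HB Require Import structures.
Require Import Defs.
From mathcomp Require Import all_boot all_order all_algebra.
From mathcomp Require Import boolp monalg finmap.
From mathcomp Require Import zify ring.
Set Implicit Arguments. Unset Strict Implicit. Unset Printing Implicit Defensive.
Import GRing.Theory.
Local Open Scope ring_scope.

(** * The monoid of power series and logarithmic derivatives *)

Section SeriesMonoid.
Variable A : comPzRingType.
Implicit Types (s t u : series A) (F : nat -> series A) (x y : A).

Lemma smul_ext s s' t t' k :
  (forall i, (i <= k)%N -> s i = s' i) -> (forall i, (i <= k)%N -> t i = t' i) ->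
  smul s t k = smul s' t' k.
Proof.
move=> es et; apply: eq_bigr => i _.
by rewrite es -1?ltnS ?ltn_ord // et ?leq_subr.
Qed.

(** With a square index range that does not depend on [k], commutativity and associativity become
    exchanges of summations. *)
Lemma smulE N s t k : (k <= N)%N ->
  smul s t k =
  \sum_(i < N.+1) \sum_(j < N.+1) (if (i + j == k)%N then s i * t j else 0).
Proof.
move=> kN; rewrite /smul.
rewrite (big_ord_widen N.+1 (fun i => s i * t (k - i)%N)) //.
rewrite [LHS]big_mkcond; apply: eq_bigr => i _ /=; case: ifPn => [ik|ik].
  have jlt : (k - i < N.+1)%N by rewrite ltnS; lia.
  rewrite (bigD1 (Ordinal jlt)) //= big1 ?addr0 => [|j jk].
    by rewrite subnKC // eqxx.
  by case: eqP => // e; case/eqP: jk; apply/val_inj => /=; lia.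
by rewrite big1 // => j _; case: eqP => //; lia.
Qed.

Lemma smulC : commutative (@smul A).
Proof.
move=> s t; apply/funext => k; rewrite !(smulE _ _ (leqnn k)) exchange_big.
by apply: eq_bigr => i _; apply: eq_bigr => j _; rewrite addnC mulrC.
Qed.

Lemma smulA : associative (@smul A).
Proof.
move=> s t u; apply/funext => k; rewrite [smul (smul s t) u]smulC.
have tri s1 s2 s3 : smul s1 (smul s2 s3) k =
    \sum_(i < k.+1) \sum_(j < k.+1) \sum_(l < k.+1)
      (if (i + j + l == k)%N then s1 i * s2 j * s3 l else 0).
  apply: eq_bigr => i _; rewrite (@smulE k) ?leq_subr // mulr_sumr.
  apply: eq_bigr => j _; rewrite mulr_sumr; apply: eq_bigr => l _.
  rewrite (_ : (j + l == k - i) = (i + j + l == k))%N; last first.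
    by have := ltn_ord i; lia.
  by case: ifP; rewrite ?mulr0 ?mulrA.
rewrite !tri exchange_big [RHS]exchange_big [LHS]exchange_big /=.
apply: eq_bigr => i _; rewrite [RHS]exchange_big.
apply: eq_bigr => j _; apply: eq_bigr => l _.
have -> : (i + j + l = l + i + j)%N by lia.
by congr (if _ then _ else _); ring.
Qed.

Lemma smul1s : left_id (sone A) (@smul A).
Proof.
move=> s; apply/funext => k; rewrite /smul big_ord_recl subn0 mul1r.
by rewrite big1 ?addr0 // => i _; rewrite mul0r.
Qed.

Lemma smuls1 : right_id (sone A) (@smul A).
Proof. by move=> s; rewrite smulC smul1s. Qed.

End SeriesMonoid.

HB.instance Definition _ (A : comPzRingType) :=
  Monoid.isComLaw.Build (series A) (sone A) (@smul A)
    (@smulA A) (@smulC A) (@smul1s A).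

Section LogarithmicDerivative.
Variable A : comPzRingType.
Implicit Types (s t u : series A) (F : nat -> series A) (x y : A).

Lemma sexpS u j : sexp u j.+1 = smul u (sexp u j).
Proof. by []. Qed.

Lemma smulACA : interchange (@smul A) (@smul A).
Proof. exact: Monoid.mulmACA. Qed.

Lemma sexp_small u j k : u 0%N = 0 -> (k < j)%N -> sexp u j k = 0.
Proof.
move=> u0; elim: j k => // j IHj k kj; apply: big1 => -[[|i] ilt] _ /=.
  by rewrite u0 mul0r.
by rewrite [X in _ * X]IHj ?mulr0 //; lia.
Qed.

(** With u = 1 - s, the product s * sum_j u^j telescopes to 1 - u^(k+1), and u^(k+1) has no term in
    t^k. *)
Lemma smul_sinv s : s 0%N = 1 -> smul s (sinv s) = sone A.
Proof.
move=> s0; apply/funext => k; set u := fun i => sone A i - s i.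
have u0 : u 0%N = 0 by rewrite /u s0 subrr.
transitivity (\sum_(j < k.+1) (sexp u j k - sexp u j.+1 k)).
  rewrite /smul; under eq_bigr => i _.
    (* The truncation in [sinv] depends on the coefficient; adding the vanishing terms with j > k -
       i gives all coefficients the same range, so that the sums can be exchanged. *)
    rewrite (_ : sinv s (k - i)%N = \sum_(j < k.+1) sexp u j (k - i)%N); last first.
      rewrite (bigID (fun j : 'I_k.+1 => (j <= k - i)%N)) /= [X in _ + X]big1.
        by rewrite addr0 (big_ord_narrow_leq (leq_subr i k)).
      by move=> j; rewrite -ltnNge => /(sexp_small u0).
    rewrite mulr_sumr; over.
  rewrite exchange_big; apply: eq_bigr => j _.
  rewrite sexpS -[in sexp u j k](smul1s (sexp u j)) /smul -sumrB.
  by apply: eq_bigr => i _; rewrite /u; ring.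
rewrite -(big_mkord predT (fun j => sexp u j k - sexp u j.+1 k)).
rewrite (telescope_sumr_eq (fun j => - sexp u j k)) //; last by move=> i _; ring.
by rewrite sexp_small // oppr0 opprK add0r.
Qed.

Lemma sinv_unique s t : s 0%N = 1 -> smul s t = sone A -> sinv s = t.
Proof.
by move=> s0 st; rewrite -[LHS]smuls1 -st smulA [smul _ s]smulC smul_sinv ?smul1s.
Qed.

Lemma smul_coef0 s t : smul s t 0%N = s 0%N * t 0%N.
Proof. by rewrite /smul big_ord_recl big_ord0 addr0. Qed.

Lemma smulDl s t u k : smul (fun i => s i + t i) u k = smul s u k + smul t u k.
Proof. by rewrite -big_split; apply: eq_bigr => i _; rewrite mulrDl. Qed.

Lemma smul_sderiv s t k :
  smul (sderiv s) t k = \sum_(i < k.+2) s i * t (k.+1 - i)%N *+ i.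
Proof.
by rewrite big_ord_recl add0r; apply: eq_bigr => i _; rewrite mulrnAl subSS.
Qed.

(** The weights i and k + 1 - i that the two summands give to s_i t_(k+1-i) add up to k + 1. *)
Lemma sderivM s t :
  sderiv (smul s t) = fun k => smul (sderiv s) t k + smul (sderiv t) s k.
Proof.
apply/funext => k; rewrite !smul_sderiv [X in _ + X](reindex_inj rev_ord_inj).
rewrite -big_split /sderiv -sumrMnl; apply: eq_bigr => -[i /= ilt] _.
rewrite subSS subKn // [t _ * _]mulrC -mulrnDr; congr (_ *+ _); lia.
Qed.

Lemma dlogM s t k :
  s 0%N = 1 -> t 0%N = 1 -> dlog (smul s t) k = dlog s k + dlog t k.
Proof.
move=> s0 t0; rewrite /dlog (@sinv_unique _ (smul (sinv s) (sinv t))); last 2 first.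
- by rewrite smul_coef0 s0 t0 mulr1.
- by rewrite smulACA !smul_sinv ?smul1s.
rewrite sderivM smulDl; congr (_ + _).
  by rewrite smulACA smul_sinv ?smuls1.
by rewrite [smul (sinv s) _]smulC smulACA smul_sinv ?smuls1.
Qed.

Lemma dlog1 k : dlog (sone A) k = 0.
Proof. by apply: big1 => i _; rewrite /sderiv /= mul0rn mul0r. Qed.

Lemma sprodS N F : sprod N.+1 F = smul (sprod N F) (F N.+1).
Proof. by rewrite /sprod big_nat_recr. Qed.

Lemma sprod_coef0 N F :
  (forall n, (0 < n)%N -> F n 0%N = 1) -> sprod N F 0%N = 1.
Proof.
move=> F0; elim: N => [|N IHN]; first by rewrite /sprod big_nil.
by rewrite sprodS smul_coef0 IHN F0 ?mulr1.
Qed.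

Lemma dlog_sprod N F k : (forall n, (0 < n)%N -> F n 0%N = 1) ->
  dlog (sprod N F) k = \sum_(1 <= n < N.+1) dlog (F n) k.
Proof.
move=> F0; elim: N => [|N IHN]; first by rewrite /sprod !big_nil dlog1.
by rewrite sprodS dlogM ?sprod_coef0 ?F0 // IHN [RHS]big_nat_recr.
Qed.

Lemma dlog_sexp s j k : s 0%N = 1 -> dlog (sexp s j) k = dlog s k *+ j.
Proof.
move=> s0; elim: j => [|j IHj]; first exact: dlog1.
rewrite dlogM ?IHj ?mulrS //.
by elim: j {IHj} => // j IHj; rewrite /= smul_coef0 s0 IHj mulr1.
Qed.

Lemma smul_lin x n s k : (0 < n)%N ->
  smul (lin x n) s k = s k - (if (n <= k)%N then x * s (k - n)%N else 0).
Proof.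
case: n => // n _; rewrite /smul big_ord_recl subn0 mul1r; congr (_ + _).
case: ltnP => nk.
  rewrite (bigD1 (Ordinal nk)) //= big1 => [|i ine].
    by rewrite /lin /= eqxx mulNr addr0.
  rewrite /lin /=; case: eqP => [[e]|_]; last by rewrite mul0r.
  by case/eqP: ine; apply/val_inj.
rewrite oppr0 big1 // => i _; rewrite /lin /=; case: eqP => [[e]|_].
  by have := ltn_ord i; move: e; rewrite /= add0n; lia.
by rewrite mul0r.
Qed.

Lemma geom_coef0 x n : geom x n 0%N = 1.
Proof. by rewrite /geom dvdn0 div0n. Qed.

Lemma smul_lin_geom x n : (0 < n)%N -> smul (lin x n) (geom x n) = sone A.
Proof.
move=> n0; apply/funext => k; rewrite smul_lin // /geom /sone.
case: (posnP k) => [->|k0]; first by rewrite dvdn0 leqNgt n0 div0n subr0.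
case: leqP => nk.
  rewrite dvdn_subl //.
  case: dvdnP => [[q kE]|_]; last by rewrite mulr0 subr0.
  case: q kE => [|q] kE; first by lia.
  by rewrite kE mulnK // mulSn addKn mulnK // -exprS subrr.
by rewrite gtnNdvd // subr0.
Qed.

(* The coefficient of [t^k] in the logarithmic derivative of [1/(1 - x t^n)]. *)
Definition ghost x n k : A :=
  if (n %| k.+1)%N then x ^+ (k.+1 %/ n) *+ n else 0.

(** The inverse of the series is 1 - x t^n. Where k + 1 = n q, multiplying the derivative by it
    leaves n q x^q - n (q - 1) x^q = n x^q. *)
Lemma dlog_geom x n k : (0 < n)%N -> dlog (geom x n) k = ghost x n k.
Proof.
move=> n0; have inv : sinv (geom x n) = lin x n.
  by apply: sinv_unique; rewrite ?geom_coef0 // smulC smul_lin_geom.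
rewrite /dlog inv smulC smul_lin // /ghost /sderiv /geom.
case: leqP => nk.
  rewrite -subSn // dvdn_subl ?(leqW nk) //.
  case: dvdnP => [[q kE]|_]; last by rewrite !mul0rn mulr0 subr0.
  case: q kE => [|q] kE; first by lia.
  by rewrite kE mulnK // mulSn addKn mulnK // mulrnAr -exprS mulrnDr addrK.
rewrite subr0; case: dvdnP => [[q kE]|_]; last by rewrite mul0rn.
(* Here k < n, so the only multiple of n that k + 1 can be is n itself. *)
by congr (_ *+ _); case: q kE => // -[|q]; lia.
Qed.

Lemma dlog_lin x n k : (0 < n)%N -> dlog (lin x n) k = - ghost x n k.
Proof.
move=> n0; rewrite -dlog_geom //; apply/eqP; rewrite -addr_eq0 -dlogM //.
  by rewrite smul_lin_geom ?dlog1.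
exact: geom_coef0.
Qed.

End LogarithmicDerivative.

(** * Infinite products and Witt coordinates *)

Section InfiniteProducts.
Variable A : comPzRingType.
Implicit Types (s t u c : series A) (F : nat -> series A) (x y : A).

Lemma sexp_ext N u v j i : (forall l, (l <= N)%N -> u l = v l) ->
  (i <= N)%N -> sexp u j i = sexp v j i.
Proof.
move=> uv; elim: j i => // j IHj i iN; rewrite !sexpS.
by apply: smul_ext => l li; rewrite ?uv ?IHj //; exact: leq_trans li iN.
Qed.

Lemma dlog_ext s t k : (forall i, (i <= k.+1)%N -> s i = t i) ->
  dlog s k = dlog t k.
Proof.
move=> st; apply: smul_ext => i ik; first by rewrite /sderiv st.
apply: eq_bigr => j _; apply: (sexp_ext (N := k.+1)) => [l lk|]; last exact: leqW.
by rewrite st.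
Qed.

Definition one_mod n s := forall i, (i < n)%N -> s i = sone A i.

Lemma smul_one_mod n s t k : one_mod n t -> (k < n)%N -> smul s t k = s k.
Proof.
move=> t1 kn; rewrite -[in RHS](smuls1 s); apply: smul_ext => // i ik.
by rewrite t1 //; exact: leq_ltn_trans ik kn.
Qed.

Lemma one_modM n s t : one_mod n s -> one_mod n t -> one_mod n (smul s t).
Proof. by move=> s1 t1 i ilt; rewrite (smul_one_mod _ t1) ?s1. Qed.

Lemma one_mod_sexp n s j : one_mod n s -> one_mod n (sexp s j).
Proof. by move=> s1; elim: j => [i //|j IHj]; exact: one_modM. Qed.

Lemma one_mod_sprod n N F : (forall d, (0 < d)%N -> one_mod n (F d)) ->
  one_mod n (sprod N F).
Proof.
move=> F1; elim: N => [i _|N IHN]; first by rewrite /sprod big_nil.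
by rewrite sprodS; apply: one_modM => //; exact: F1.
Qed.

Lemma one_mod_coef0 n s : (0 < n)%N -> one_mod n s -> s 0%N = 1.
Proof. by move=> n0 /(_ _ n0). Qed.

Lemma one_mod_lin x m n : (n <= m)%N -> one_mod n (lin x m).
Proof. by move=> nm [|i] ilt //; rewrite /lin /=; case: eqP => //; lia. Qed.

Lemma one_mod_geom x m n : (n <= m)%N -> one_mod n (geom x m).
Proof.
move=> nm [|i] ilt; first exact: geom_coef0.
by rewrite /geom gtnNdvd //; exact: leq_trans ilt nm.
Qed.

Lemma smul_coef_one_mod n s t : one_mod n.+1 t ->
  smul s t n.+1 = s n.+1 + s 0%N * t n.+1.
Proof.
move=> t1; rewrite smulC /smul big_ord_recl big_ord_recr /= subn0 t1 // mul1r.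
rewrite big1 ?add0r => [|[i ilt] _ /=]; last by rewrite t1 ?mul0r.
by rewrite /bump /= add1n subnn mulrC.
Qed.

(** Convergence condition under which the truncations used by [sinfprod] agree with all later
    partial products. *)
Definition tame F := forall n, (0 < n)%N -> one_mod n (F n).

Lemma tame_coef0 F n : tame F -> (0 < n)%N -> F n 0%N = 1.
Proof. by move=> tF n0; apply: (one_mod_coef0 n0); exact: tF. Qed.

Lemma sprod_stable F N k : tame F -> (k <= N)%N -> sprod N F k = sinfprod F k.
Proof.
move=> tF; elim: N => [|N IHN]; first by case: k.
rewrite leq_eqVlt => /predU1P[-> //|kN].
by rewrite sprodS (smul_one_mod _ (tF _ _)) ?IHN.
Qed.

(** The leading coefficient of factor m + 1 enters additively. This triangular shape is what allows
    coordinates to be solved for one at a time. *)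
Lemma sinfprod_coefS F m : tame F ->
  sinfprod F m.+1 = sprod m F m.+1 + F m.+1 m.+1.
Proof.
move=> tF; rewrite /sinfprod sprodS smul_coef_one_mod; last exact: tF.
by rewrite sprod_coef0 ?mul1r // => n; exact: tame_coef0.
Qed.

Lemma dlog_sinfprod F k : tame F ->
  dlog (sinfprod F) k = \sum_(1 <= n < k.+2) dlog (F n) k.
Proof.
move=> tF; rewrite -dlog_sprod => [|n]; last exact: tame_coef0.
by apply: dlog_ext => i ik; rewrite sprod_stable.
Qed.

Lemma tame_geom (a : nat -> A) : tame (fun n => geom (a n) n).
Proof. by move=> n _; exact: one_mod_geom. Qed.

Lemma size_wittseq c m : size (wittseq c m) = m.
Proof. by elim: m => //= m IHm; rewrite size_rcons IHm. Qed.

Lemma nth_wittseq c m i : (i < m)%N -> nth 0 (wittseq c m) i = witt c i.+1.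
Proof.
elim: m => // m IHm; rewrite ltnS leq_eqVlt => /predU1P[-> //|im].
by rewrite /= nth_rcons size_wittseq im IHm.
Qed.

Lemma witt_rec c m :
  witt c m.+1 = c m.+1 - sprod m (fun n => geom (witt c n) n) m.+1.
Proof.
rewrite -[LHS]/(nth 0 (rcons (wittseq c m) (c m.+1 -
  sprod m (fun n => geom (nth 0 (wittseq c m) n.-1) n) m.+1)) m).
rewrite nth_rcons size_wittseq ltnn eqxx; congr (_ - _); congr (_ _).
by apply: eq_big_nat => -[|n] // nm; rewrite nth_wittseq.
Qed.

Lemma wittK c k : c 0%N = 1 -> sinfprod (fun n => geom (witt c n) n) k = c k.
Proof.
case: k => [c0|k _]; first by rewrite /sinfprod /sprod big_nil c0.
rewrite sinfprod_coefS; last exact: tame_geom.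
by rewrite {2}/geom dvdnn divnn expr1 witt_rec addrC subrK.
Qed.

Lemma witt_unique c (a : nat -> A) :
  (forall k, sinfprod (fun n => geom (a n) n) k = c k) ->
  forall n, (0 < n)%N -> witt c n = a n.
Proof.
move=> ac n; elim/ltn_ind: n => -[//|n] IHn _.
rewrite witt_rec -ac sinfprod_coefS; last exact: tame_geom.
rewrite {2}/geom dvdnn divnn expr1 addrAC.
rewrite (_ : sprod n _ = sprod n (fun n => geom (witt c n) n)); last first.
  by apply: eq_big_nat => m /andP[m0 mn]; rewrite IHn.
by rewrite subrr add0r.
Qed.

Lemma witt_coords_surj (a : nat -> A) :
  exists x : nat -> A, forall n, (0 < n)%N -> witt (toser x) n = a n.
Proof.
exists (fun k => sinfprod (fun n => geom (a n) n) k.+1).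
by apply: witt_unique => -[|k] //; rewrite /sinfprod /sprod big_nil.
Qed.

Lemma witt_coords_inj (x y : nat -> A) :
  (forall n, (0 < n)%N -> witt (toser x) n = witt (toser y) n) -> x = y.
Proof.
move=> xy; apply/funext => k.
have toserK (z : nat -> A) : z k = sinfprod (fun n => geom (witt (toser z) n) n) k.+1.
  by rewrite wittK.
rewrite (toserK x) (toserK y) /sinfprod.
by congr (_ _); apply: eq_big_nat => n /andP[n0 _]; rewrite xy.
Qed.

Definition theta (r : A) (a : nat -> A) n := smul (lin (r * a n) n) (geom (a n) n).

Lemma tame_theta r a : tame (theta r a).
Proof. by move=> n _; apply: one_modM; [exact: one_mod_lin|exact: one_mod_geom]. Qed.

Lemma dlog_lin_geom x y n k : (0 < n)%N ->
  dlog (smul (lin x n) (geom y n)) k = ghost y n k - ghost x n k.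
Proof. by move=> n0; rewrite dlogM ?geom_coef0 // dlog_lin // dlog_geom // addrC. Qed.

Lemma Upsilon_ghost (g : {poly int}) (q : A) (x : nat -> A) k :
  let a := witt (toser x) in
  Upsilon g q x k =
  \sum_(1 <= n < k.+2) (ghost (a n) n k - ghost (gval g q * a n) n k).
Proof.
rewrite /Upsilon -/(theta _ _) dlog_sinfprod; last exact: tame_theta.
by apply: eq_big_nat => n /andP[n0 _]; rewrite /theta dlog_lin_geom.
Qed.

Lemma ghost_diag x n : ghost x n.+1 n = x *+ n.+1.
Proof. by rewrite /ghost dvdnn divnn expr1. Qed.

(** Strong induction: once the earlier coordinates agree, the ghost coefficient of index n differs
    only in its last term (n + 1) (1 - g(q)) a_(n+1), from which a_(n+1) is recovered by
    regularity. *)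
Lemma Upsilon_inj (g : {poly int}) (q : A) (x y : nat -> A) :
  (forall n (u : A), (0 < n)%N -> (1 - gval g q) * u *+ n = 0 -> u = 0) ->
  Upsilon g q x =1 Upsilon g q y -> x = y.
Proof.
move=> reg xy; apply: witt_coords_inj => n; elim/ltn_ind: n => -[//|n] IHn _.
apply/eqP; rewrite -subr_eq0; apply/eqP/(reg n.+1) => //.
have := xy n; rewrite !Upsilon_ghost [LHS]big_nat_recr //= [RHS]big_nat_recr //=.
rewrite (eq_big_nat _ _ (F2 := fun m => ghost (witt (toser y) m) m n -
   ghost (gval g q * witt (toser y) m) m n)); last first.
  by move=> m /andP[m0 mn]; rewrite IHn.
move/addrI; rewrite !ghost_diag => /eqP; rewrite -subr_eq0 => /eqP <-.
by rewrite -!mulrnBl; congr (_ *+ _); ring.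
Qed.

End InfiniteProducts.

(** * Naturality of Witt coordinates and of the ghost map *)

Section Naturality.
Variables (A B : comPzRingType) (f : {rmorphism A -> B}).

Lemma smul_map (s t : series A) : f \o smul s t = smul (f \o s) (f \o t).
Proof.
by apply/funext => k; rewrite /= rmorph_sum; apply: eq_bigr => i _; rewrite rmorphM.
Qed.

Lemma sprod_map N (F : nat -> series A) :
  f \o sprod N F = sprod N (fun n => f \o F n).
Proof.
elim: N => [|N IHN]; last by rewrite !sprodS smul_map IHN.
rewrite /sprod !big_nil; apply/funext => k.
by rewrite /sone /=; case: ifP; rewrite ?rmorph1 ?rmorph0.
Qed.

Lemma geom_map (x : A) n : f \o geom x n = geom (f x) n.
Proof.
by apply/funext => k; rewrite /geom /=; case: ifP; rewrite ?rmorphXn ?rmorph0.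
Qed.

Lemma witt_map (c : series A) n : (0 < n)%N -> witt (f \o c) n = f (witt c n).
Proof.
elim/ltn_ind: n => -[//|n] IHn _; rewrite !witt_rec rmorphB /=.
congr (_ - _); rewrite -[RHS]/((f \o sprod _ _) _) sprod_map; congr (_ _).
by apply: eq_big_nat => m /andP[m0 mn]; rewrite geom_map IHn.
Qed.

Lemma gval_map (g : {poly int}) (q : A) : f (gval g q) = gval g (f q).
Proof.
rewrite rmorph_sum; apply: eq_bigr => i _.
by rewrite rmorphM rmorph_int rmorphXn.
Qed.

Lemma Upsilon_map (g : {poly int}) (q : A) (x : nat -> A) k :
  f (Upsilon g q x k) = Upsilon g (f q) (f \o x) k.
Proof.
rewrite !Upsilon_ghost rmorph_sum; apply: eq_big_nat => n /andP[n0 _].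
have -> : toser (f \o x) = f \o toser x.
  by apply/funext => -[|i] //=; rewrite rmorph1.
rewrite witt_map // rmorphB -gval_map -rmorphM /ghost /=.
by case: ifP => _; rewrite ?rmorph0 // !rmorphMn !rmorphXn.
Qed.

End Naturality.

(** * Series congruent to 1 modulo 1 - r *)

(** Dependent choice along finite prefixes, for coordinates that are only known to exist one after
    another. *)
Lemma seq_choice (T : Type) (P : seq T -> Prop) :
  P [::] -> (forall w, P w -> exists x, P (rcons w x)) ->
  exists a : nat -> T, forall n, P (mkseq a n).
Proof.
move=> P0 step; pose next (w : {w | P w}) := cid (step _ (svalP w)).
pose W := fix W n : {w | P w} :=
  if n is m.+1 then exist P _ (svalP (next (W m))) else exist P _ P0.
exists (fun n => sval (next (W n))) => n.
suff -> : mkseq (fun n => sval (next (W n))) n = sval (W n) by exact: svalP.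
by elim: n => // n IHn; rewrite mkseqS IHn.
Qed.

Section Congruence.
Variables (A : comPzRingType) (r : A).
Implicit Types (s t : series A) (F : nat -> series A) (x y : A).

Definition congr1r x y := exists e, x - y = (1 - r) * e.
Definition scongr s t := forall k, congr1r (s k) (t k).

Lemma congr1r_refl x : congr1r x x.
Proof. by exists 0; rewrite subrr mulr0. Qed.

Lemma congr1r_mull x : congr1r (r * x) x.
Proof. by exists (- x); ring. Qed.

Lemma congr1rD x x' y y' :
  congr1r x x' -> congr1r y y' -> congr1r (x + y) (x' + y').
Proof. by move=> [e xE] [e' yE]; exists (e + e'); rewrite mulrDr -xE -yE; ring. Qed.

Lemma congr1rM x x' y y' :
  congr1r x x' -> congr1r y y' -> congr1r (x * y) (x' * y').
Proof.
move=> [e xE] [e' yE]; exists (e * y + x' * e').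
by rewrite mulrDr mulrA -xE mulrCA -yE; ring.
Qed.

Lemma congr1rX x y n : congr1r x y -> congr1r (x ^+ n) (y ^+ n).
Proof.
move=> xy; elim: n => [|n IHn]; first exact: congr1r_refl.
by rewrite !exprS; exact: congr1rM.
Qed.

Lemma scongr_smul s s' t t' :
  scongr s s' -> scongr t t' -> scongr (smul s t) (smul s' t').
Proof.
move=> ss' tt' k; apply: (big_ind2 congr1r) => [|*|i _]; first exact: congr1r_refl.
  exact: congr1rD.
exact: congr1rM.
Qed.

Lemma scongr1M s t :
  scongr s (sone A) -> scongr t (sone A) -> scongr (smul s t) (sone A).
Proof. by move=> s1 t1; rewrite -(smul1s (sone A)); exact: scongr_smul. Qed.

Lemma scongr1_sprod N F : (forall n, (0 < n)%N -> scongr (F n) (sone A)) ->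
  scongr (sprod N F) (sone A).
Proof.
move=> F1; elim: N => [k|N IHN]; first by rewrite /sprod big_nil; exact: congr1r_refl.
by rewrite sprodS; apply: scongr1M => //; exact: F1.
Qed.

Lemma scongr1_sinfprod F : (forall n, (0 < n)%N -> scongr (F n) (sone A)) ->
  scongr (sinfprod F) (sone A).
Proof. by move=> F1 k; exact: scongr1_sprod. Qed.

Lemma scongr1_sexp s j : scongr s (sone A) -> scongr (sexp s j) (sone A).
Proof.
move=> s1; elim: j => [k|j IHj]; first exact: congr1r_refl.
by rewrite sexpS; exact: scongr1M.
Qed.

(** Writing 1 as (1 - y t^n)/(1 - y t^n) leaves only the linear factors to compare. *)
Lemma scongr1_lin_geom x y n : (0 < n)%N -> congr1r x y ->
  scongr (smul (lin x n) (geom y n)) (sone A).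
Proof.
move=> n0 [e xy]; rewrite -(smul_lin_geom y n0); apply: scongr_smul => k.
  rewrite /lin; do 2![case: ifP => _; first exact: congr1r_refl || idtac].
    by exists (- e); rewrite mulrN -xy; ring.
  exact: congr1r_refl.
exact: congr1r_refl.
Qed.

Lemma scongr1_theta a n : (0 < n)%N -> scongr (theta r a n) (sone A).
Proof. by move=> n0; apply: scongr1_lin_geom => //; exact: congr1r_mull. Qed.

Lemma theta_diag a n : theta r a n.+1 n.+1 = (1 - r) * a n.+1.
Proof.
rewrite /theta smul_lin // leqnn subnn geom_coef0 mulr1 /geom dvdnn divnn expr1.
by ring.
Qed.

(** The partial product and s are both congruent to 1, so their discrepancy at t^(m+1) is (1 - r) e
    for some e. By [theta_diag], the coordinate a_(m+1) = e corrects it. As 1 - r may be a zero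
    divisor, e has to be chosen. *)
Lemma theta_surj s : s 0%N = 1 -> scongr s (sone A) ->
  exists a, forall k, sinfprod (theta r a) k = s k.
Proof.
move=> s0 s1.
(* Coordinates start at 1, so a_n is the entry of index n - 1. [P w] involves only factors with n at
   most [size w], hence never the default 0. *)
pose F w := theta r (fun n => nth 0 w n.-1).
pose P w := forall k, (k <= size w)%N -> sinfprod (F w) k = s k.
have [||a aP] := @seq_choice A P.
- by case=> // _; rewrite /sinfprod /sprod big_nil.
- move=> w Pw; set m := size w.
  have [e eE] : congr1r (s m.+1) (sprod m (F w) m.+1).
    have [e1 E1] := s1 m.+1.
    have [e2 E2] := @scongr1_sprod m (F w) (@scongr1_theta _) m.+1.
    by exists (e1 - e2); rewrite mulrBr -E1 -E2; ring.
  have FE N : (N <= m)%N -> sprod N (F (rcons w e)) = sprod N (F w).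
    move=> Nm; apply: eq_big_nat => -[//|n] nN.
    rewrite /F /theta /= nth_rcons -/m ifT //; lia.
  exists e => k; rewrite size_rcons -/m leq_eqVlt => /predU1P[->|km].
    rewrite sinfprod_coefS; last exact: tame_theta.
    by rewrite FE // [F _ _ _]theta_diag /= nth_rcons ltnn eqxx -eE addrC subrK.
  by rewrite /sinfprod FE // [LHS]Pw.
exists (fun n => a n.-1) => k; rewrite -(aP k k) ?size_mkseq //.
rewrite /sinfprod; congr (_ _); apply: eq_big_nat => -[//|n] nk.
by rewrite /F /theta /= nth_mkseq.
Qed.

End Congruence.

(** * Products of ghost terms *)

Section GhostArithmetic.
Variable A : comPzRingType.
Implicit Types (u v : A).

Lemma lcmn_mul_gcdn d e : (d * (e %/ gcdn d e))%N = lcmn d e.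
Proof. by rewrite muln_divA // dvdn_gcdr. Qed.

(** Both d and e divide k + 1 exactly when their lcm L does. With h their gcd, the weights satisfy d
    e = L h, and the exponents match because L / d = e / h and L / e = d / h. *)
Lemma ghostM u v d e k : (0 < d)%N -> (0 < e)%N ->
  ghost u d k * ghost v e k =
  ghost (u ^+ (e %/ gcdn d e) * v ^+ (d %/ gcdn d e)) (lcmn d e) k *+ gcdn d e.
Proof.
move=> d0 e0; rewrite /ghost dvdn_lcm.
case: ifP => [dk|_] /=; last by rewrite mul0r mul0rn.
case: ifP => [ek|_] /=; last by rewrite mulr0 mul0rn.
have Lk : (lcmn d e %| k.+1)%N by rewrite dvdn_lcm dk.
rewrite -mulrnA muln_lcm_gcd mulrnAl mulrnAr -mulrnA [(e * d)%N]mulnC.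
rewrite exprMn -!exprM; congr (_ ^+ _ * _ ^+ _ *+ _).
  apply/eqP; rewrite -(eqn_pmul2l d0) mulnA lcmn_mul_gcdn.
  by rewrite [(d * _)%N]mulnC [(lcmn _ _ * _)%N]mulnC !divnK.
apply/eqP; rewrite -(eqn_pmul2l e0) mulnA [gcdn d e]gcdnC lcmn_mul_gcdn lcmnC.
by rewrite [(e * _)%N]mulnC [(lcmn _ _ * _)%N]mulnC !divnK.
Qed.

(** Pairs (d, e) are grouped by their maximum n, which turns a double product into a single one
    indexed by n. *)
Lemma sum_square (H : nat -> nat -> A) N :
  \sum_(1 <= n < N.+1) (H n n + \sum_(1 <= d < n) (H d n + H n d)) =
  \sum_(1 <= d < N.+1) \sum_(1 <= e < N.+1) H d e.
Proof.
elim: N => [|N IHN]; first by rewrite !big_nil.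
rewrite big_nat_recr //= IHN [RHS]big_nat_recr //= [X in _ = _ + X]big_nat_recr //= big_split /=.
under [X in _ = X + _]eq_bigr do rewrite big_nat_recr //=.
by rewrite [in RHS]big_split /=; ring.
Qed.

End GhostArithmetic.

(** * The image of the ghost map is closed under the ring operations *)

Section GhostImage.
Variables (A : comPzRingType) (g : {poly int}) (q : A).
Let r := gval g q.
Implicit Types (s : series A) (x y : nat -> A).

Lemma Upsilon_surj s : s 0%N = 1 -> scongr r s (sone A) ->
  exists x, Upsilon g q x =1 dlog s.
Proof.
move=> s0 s1; have [a aE] := theta_surj s0 s1.
have [x xE] := witt_coords_surj a; exists x => k; apply: dlog_ext => i _.
rewrite -aE /sinfprod; congr (_ _); apply: eq_big_nat => n /andP[n0 _].
by rewrite xE.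
Qed.

Lemma sinfprod_surj F : tame F ->
  (forall n, (0 < n)%N -> scongr r (F n) (sone A)) ->
  exists x, forall k, Upsilon g q x k = \sum_(1 <= n < k.+2) dlog (F n) k.
Proof.
move=> tF F1; have [||x xE] := @Upsilon_surj (sinfprod F).
- by rewrite /sinfprod /sprod big_nil.
- exact: scongr1_sinfprod.
by exists x => k; rewrite xE dlog_sinfprod.
Qed.

Lemma Upsilon_zero : exists z, forall k, Upsilon g q z k = 0.
Proof.
have [//|k|z zE] := @Upsilon_surj (sone A); first exact: congr1r_refl.
by exists z => k; rewrite zE dlog1.
Qed.

Lemma Upsilon_add x y :
  exists z, forall k, Upsilon g q z k = Upsilon g q x k + Upsilon g q y k.
Proof.
pose F a := theta r (witt (toser a)).
have [||z zE] := @sinfprod_surj (fun n => smul (F x n) (F y n)).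
- by move=> n n0; apply: one_modM; exact: tame_theta.
- by move=> n n0; apply: scongr1M; exact: scongr1_theta.
exists z => k; rewrite zE !Upsilon_ghost -big_split; apply: eq_big_nat => n /andP[n0 _].
have F0 a : F a n 0%N = 1 by apply: tame_coef0 n0; exact: tame_theta.
by rewrite dlogM // [dlog (F x n) k]dlog_lin_geom // [dlog (F y n) k]dlog_lin_geom.
Qed.

Lemma Upsilon_opp x : exists z, forall k, Upsilon g q z k = - Upsilon g q x k.
Proof.
pose a := witt (toser x).
(* Exchanging numerator and denominator inverts each factor, which negates its logarithmic
   derivative. *)
have [||z zE] := @sinfprod_surj (fun n => smul (lin (a n) n) (geom (r * a n) n)).
- by move=> n _; apply: one_modM; [exact: one_mod_lin|exact: one_mod_geom].
- move=> n n0; apply: scongr1_lin_geom => //.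
  by have [e eE] := congr1r_mull r (a n); exists (- e); rewrite mulrN -eE opprB.
exists z => k; rewrite zE Upsilon_ghost -sumrN; apply: eq_big_nat => n /andP[n0 _].
by rewrite dlog_lin_geom // opprB.
Qed.

Lemma Upsilon_mul x y :
  exists z, forall k, Upsilon g q z k = Upsilon g q x k * Upsilon g q y k.
Proof.
pose a := witt (toser x); pose b := witt (toser y).
pose c d e u v := u ^+ (e %/ gcdn d e) * v ^+ (d %/ gcdn d e) : A.
(* Witt's formula: the product of 1/(1 - u t^d) and 1/(1 - v t^e) is
   (1 - u^(e/h) v^(d/h) t^lcm(d,e))^(-h) with h = gcd(d,e). *)
pose E d e := sexp (smul
  (smul (lin (c d e (r * a d) (b e)) (lcmn d e)) (geom (c d e (a d) (b e)) (lcmn d e)))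
  (smul (lin (c d e (a d) (r * b e)) (lcmn d e))
        (geom (c d e (r * a d) (r * b e)) (lcmn d e)))) (gcdn d e).
have E_one n d e : (n <= lcmn d e)%N -> one_mod n (E d e).
  move=> nL; apply/one_mod_sexp/one_modM; apply: one_modM;
    by [exact: one_mod_lin|exact: one_mod_geom].
(* The four terms of the expanded product are paired so that numerator and denominator differ only
   by [r * a d] in place of [a d], hence are congruent. In the second pair the roles are reversed,
   which accounts for the sign. *)
have E_congr d e : (0 < d)%N -> (0 < e)%N -> scongr r (E d e) (sone A).
  move=> d0 e0; have L0 : (0 < lcmn d e)%N by rewrite lcmn_gt0 d0.
  have cE u v : congr1r r (c d e (r * u) v) (c d e u v).
    apply: congr1rM; last exact: congr1r_refl.
    by apply/congr1rX/congr1r_mull.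
  apply/scongr1_sexp/scongr1M; apply: scongr1_lin_geom => //.
  by have [h hE] := cE (a d) (r * b e); exists (- h); rewrite mulrN -hE opprB.
have E_dlog d e k : (0 < d)%N -> (0 < e)%N -> dlog (E d e) k =
    (ghost (a d) d k - ghost (r * a d) d k) * (ghost (b e) e k - ghost (r * b e) e k).
  move=> d0 e0; have L0 : (0 < lcmn d e)%N by rewrite lcmn_gt0 d0.
  rewrite dlog_sexp ?smul_coef0 ?geom_coef0 ?mulr1 // dlogM ?smul_coef0 ?geom_coef0 ?mulr1 //.
  rewrite !dlog_lin_geom // mulrBl !mulrBr !ghostM // -!mulrnBl -/(c _ _ _ _).
  by rewrite -!/(c d e _ _); ring.
(* All pairs with maximum n go into factor n; their lcm is at least n, so the family is tame. *)
pose F n := smul (E n n) (sprod n.-1 (fun d => smul (E d n) (E n d))).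
have [||z zE] := @sinfprod_surj F.
- move=> n n0; apply: one_modM; last (apply: one_mod_sprod => d d0; apply: one_modM);
    by apply: E_one; apply: dvdn_leq; rewrite ?lcmn_gt0 ?n0 ?d0 ?dvdn_lcml ?dvdn_lcmr.
- move=> n n0; apply: scongr1M; first exact: E_congr.
  by apply: scongr1_sprod => d d0; apply: scongr1M; exact: E_congr.
exists z => k; rewrite zE !Upsilon_ghost mulr_suml.
under [RHS]eq_bigr do rewrite mulr_sumr.
rewrite -sum_square; apply: eq_big_nat => -[//|n] _.
have E0 d e : (0 < d)%N -> (0 < e)%N -> E d e 0%N = 1.
  by move=> d0 e0; apply: (@one_mod_coef0 _ 1) => //; apply: E_one; rewrite lcmn_gt0 d0.
have EE0 d : (0 < d)%N -> smul (E d n.+1) (E n.+1 d) 0%N = 1.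
  by move=> d0; rewrite smul_coef0 !E0 ?mulr1.
rewrite dlogM ?E0 ?sprod_coef0 //= E_dlog // dlog_sprod //; congr (_ + _).
by apply: eq_big_nat => d /andP[d0 _]; rewrite dlogM ?E0 // !E_dlog.
Qed.

End GhostImage.

(** * The free algebra *)

Definition univ : comNzRingType := {malg {poly int}[{cmonom nat}]}.
Definition univ_q : univ := malgC 'X.
Definition univ_X (i : nat) : univ := mkmalgU (ucm i) 1.

Section Evaluation.
Variables (A : comPzRingType) (q : A) (x : nat -> A).

Definition monom_eval (m : {cmonom nat}) : A := \prod_(i <- finsupp m) x i ^+ m i.
(** A bare sum makes sense in every algebra, the zero ring included; that it is a ring morphism is
    shown in [univ_eval_rmorph]. *)
Definition univ_eval (u : univ) : A :=
  \sum_(m <- msupp u) gval (mcoeff m u) q * monom_eval m.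

End Evaluation.

Section EvaluationNz.
Variables (A : comNzRingType) (q : A) (x : nat -> A).

Lemma monom_eval_morph : mmorphism (monom_eval x : {cmonom nat} -> A).
Proof.
(* Two monomials with different supports are compared over the union of these supports. *)
have wide (E : {fset nat}) (m : {cmonom nat}) : (finsupp m `<=` E)%fset ->
    monom_eval x m = \prod_(i <- E) x i ^+ m i.
  move=> mE; rewrite /monom_eval (big_fset_incl _ mE) // => i _.
  by rewrite -cmE_eq0 => /eqP ->.
split=> [m1 m2|]; last by rewrite /monom_eval mdom1 big_seq_fset0.
rewrite {1}/monom_eval mdomD (wide _ _ (fsubsetUl _ (finsupp m2))).
rewrite (wide _ _ (fsubsetUr (finsupp m1) _)) -big_split /=.
by apply: eq_bigr => i _; rewrite cmM exprD.
Qed.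

HB.instance Definition _ := isMultiplicative.Build _ _ (monom_eval x) monom_eval_morph.

Lemma gval_horner (p : {poly int}) :
  gval p q = horner_morph (fun z => mulrC q z%:~R) p.
Proof.
rewrite /horner_morph (horner_coef_wide _ (size_poly _ _)).
by apply: eq_bigr => i _; rewrite coef_map.
Qed.

Lemma univ_eval_nz : exists f : {rmorphism univ -> A}, f =1 univ_eval q x.
Proof.
exists (mmap (horner_morph (fun z => mulrC q z%:~R)) (monom_eval x)) => u.
by apply: eq_bigr => m _; rewrite gval_horner.
Qed.

End EvaluationNz.

(* The evaluation morphisms of monalg require a nonzero codomain. *)
Definition nontrivial_ring (A : comPzRingType) (A1 : (1 : A) != 0) : comNzRingType :=
  HB.pack (GRing.ComPzRing.sort A) (GRing.PzSemiRing_isNonZero.Build A A1).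

Lemma univ_eval_rmorph (A : comPzRingType) (q : A) (x : nat -> A) :
  exists f : {rmorphism univ -> A}, f =1 univ_eval q x.
Proof.
case: (eqVneq (1 : A) 0) => [A0|]; last first.
  case: A q x => A cA q x A1.
  by have [f fE] := @univ_eval_nz (nontrivial_ring A1) q x; exists f.
have all0 (y : A) : y = 0 by rewrite -[y]mul1r A0 mul0r.
pose f (_ : univ) : A := 0.
have fB : zmod_morphism f by move=> u v; rewrite [RHS]all0.
have fM : monoid_morphism f by split=> [|u v]; rewrite [LHS]all0 [RHS]all0.
pose fa := GRing.isZmodMorphism.Build _ _ f fB.
pose fm := GRing.isMonoidMorphism.Build _ _ f fM.
pose fr : {rmorphism univ -> A} := HB.pack f fa fm.
by exists fr => u; rewrite [LHS]all0 [RHS]all0.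
Qed.

Lemma gvalX (A : comPzRingType) (q : A) : gval 'X q = q.
Proof.
by rewrite /gval size_polyX !big_ord_recl big_ord0 !coefX /= mul0r add0r mul1r addr0.
Qed.

Lemma gval_polyX (g : {poly int}) : gval g 'X = g.
Proof.
rewrite -[RHS]coefK poly_def; apply: eq_bigr => i _.
by rewrite -mul_polyC -[in RHS](intz g`_i) rmorph_int.
Qed.

Lemma univ_eval_q (A : comPzRingType) (q : A) x : univ_eval q x univ_q = q.
Proof.
rewrite /univ_eval msuppU polyX_eq0 big_seq_fset1 mcoeffUU gvalX.
by rewrite /monom_eval mdom1 big_seq_fset0 mulr1.
Qed.

Lemma univ_eval_X (A : comPzRingType) (q : A) x i : univ_eval q x (univ_X i) = x i.
Proof.
rewrite /univ_eval msuppU oner_eq0 big_seq_fset1 mcoeffUU.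
rewrite /monom_eval mdomU big_seq_fset1 cmUU expr1.
by rewrite /gval size_poly1 big_ord1 coef1 mulr1 mul1r.
Qed.

Lemma univ_eval_map (A B : comPzRingType) (f : {rmorphism A -> B}) (q : A) x u :
  f (univ_eval q x u) = univ_eval (f q) (f \o x) u.
Proof.
rewrite rmorph_sum; apply: eq_bigr => m _; rewrite rmorphM gval_map.
by congr (_ * _); rewrite rmorph_prod; apply: eq_bigr => i _; rewrite rmorphXn.
Qed.

(** * Injectivity over the free algebra, and uniqueness *)

Lemma gval_univ_q (g : {poly int}) : gval g univ_q = malgC g.
Proof. by rewrite -[in RHS](gval_polyX g) gval_map. Qed.

(** Since 1 - g is a constant of the free algebra, the equation can be read monomial by monomial in
    Z[q], a domain of characteristic 0. *)
Lemma univ_ghost_regular (g : {poly int}) : g != 1 ->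
  forall n (u : univ), (0 < n)%N -> (1 - gval g univ_q) * u *+ n = 0 -> u = 0.
Proof.
move=> g1 n u n0; rewrite gval_univ_q -[1 : univ]/(malgC 1) -rmorphB /= mul_malgC.
move=> e; apply/malgP => m; rewrite mcoeff0; move: (congr1 (mcoeff m) e).
rewrite mcoeffMn mcoeffZ mcoeff0 -mulr_natr => /eqP.
rewrite !mulf_eq0 subr_eq0 eq_sym (negbTE g1) /= -polyC_natr polyC_eq0.
by rewrite Num.Theory.pnatr_eq0 eqn0Ngt n0 orbF => /eqP.
Qed.

Lemma univ_Upsilon_inj (g : {poly int}) (x y : nat -> univ) : g != 1 ->
  Upsilon g univ_q x =1 Upsilon g univ_q y -> x = y.
Proof. by move=> g1; apply: Upsilon_inj; exact: univ_ghost_regular. Qed.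

Lemma univ_lift (A : comPzRingType) (q : A) (x y z : nat -> A) :
  exists f : {rmorphism univ -> A}, exists x' y' z' : nat -> univ,
    [/\ f univ_q = q, x = f \o x', y = f \o y' & z = f \o z'].
Proof.
(* The variables X_(3i), X_(3i+1), X_(3i+2) take the values x_i, y_i, z_i, so one morphism lifts
   three sequences. *)
pose w k := nth 0 [:: x (k %/ 3)%N; y (k %/ 3)%N; z (k %/ 3)%N] (k %% 3).
have [f fE] := univ_eval_rmorph q w; exists f.
exists (fun i => univ_X (i * 3)), (fun i => univ_X (i * 3 + 1)).
exists (fun i => univ_X (i * 3 + 2)); split; first by rewrite fE univ_eval_q.
all: apply/funext => i; rewrite /= fE univ_eval_X /w.
- by rewrite modnMl mulnK.
- by rewrite modnMDl divnMDl //= addn0.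
- by rewrite modnMDl divnMDl //= addn0.
Qed.

(** Sum and product are compared on lifts to the free algebra. Zero and opposite are then forced by
    the group axioms alone. *)
Lemma is_lambda_bar_unique (g : {poly int}) (F1 F2 : lamfun) : g != 1 ->
  is_lambda_bar g F1 -> is_lambda_bar g F2 ->
  forall (A : comPzRingType) (q : A) (x y : nat -> A),
    radd (F1 A q) x y = radd (F2 A q) x y /\
    rmul (F1 A q) x y = rmul (F2 A q) x y /\
    rzero (F1 A q) = rzero (F2 A q) /\
    ropp (F1 A q) x = ropp (F2 A q) x.
Proof.
move=> g1 [ax1 [nat1 ups1]] [ax2 [nat2 ups2]] A q.
have op_eq x y : radd (F1 A q) x y = radd (F2 A q) x y /\
                 rmul (F1 A q) x y = rmul (F2 A q) x y.
  have [f [x' [y' [_ [fq -> -> _]]]]] := univ_lift q x y y.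
  have [<- <-] := nat1 _ _ _ _ f fq x' y'.
  have [<- <-] := nat2 _ _ _ _ f fq x' y'.
  by split; apply/funext => k; congr (f _); congr (_ k);
    apply: (univ_Upsilon_inj g1) => i;
    have [a1 m1] := ups1 _ univ_q x' y' i; have [a2 m2] := ups2 _ univ_q x' y' i;
    rewrite ?a1 ?a2 ?m1 ?m2.
have addE x y := (op_eq x y).1.
have [A1 [C1 [Z1 [N1 _]]]] := ax1 A q; have [A2 [C2 [Z2 [N2 _]]]] := ax2 A q.
have zE : rzero (F1 A q) = rzero (F2 A q).
  by rewrite -[LHS]Z2 -addE C1 Z1.
move=> x y; rewrite addE (op_eq x y).2; do 3!split=> //.
rewrite -[LHS]Z2 -(N2 x) -A2 -[radd _ x _]addE C1 N1 zE.
by rewrite C2 Z2.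
Qed.

(** * Universal operations and existence *)

Definition interleave (T : Type) (x y : nat -> T) k :=
  if odd k then y k./2 else x k./2.

Definition univ_op (s : nat -> univ) (A : comPzRingType) (q : A) (x y : nat -> A) :
  nat -> A := fun k => univ_eval q (interleave x y) (s k).

Lemma univ_op_map s (A B : comPzRingType) (f : {rmorphism A -> B}) (q : A) x y :
  f \o univ_op s q x y = univ_op s (f q) (f \o x) (f \o y).
Proof.
apply/funext => k; rewrite /univ_op /= univ_eval_map; congr (univ_eval _ _ _).
by apply/funext => i; rewrite /interleave /=; case: ifP.
Qed.

Definition univ_x i := univ_X i.*2.
Definition univ_y i := univ_X i.*2.+1.

(** A ghost identity for the generic pair [univ_x], [univ_y] specialises to every pair, as
    evaluation sends the generic sequences to x and y. *)
Lemma Upsilon_univ_op s (A : comPzRingType) (q : A) x y :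
  exists f : {rmorphism univ -> A},
    [/\ forall k, Upsilon 'X q (univ_op s q x y) k = f (Upsilon 'X univ_q s k),
        forall k, Upsilon 'X q x k = f (Upsilon 'X univ_q univ_x k) &
        forall k, Upsilon 'X q y k = f (Upsilon 'X univ_q univ_y k)].
Proof.
have [f fE] := univ_eval_rmorph q (interleave x y); exists f.
have fq : f univ_q = q by rewrite fE univ_eval_q.
split=> k; rewrite Upsilon_map fq; congr (Upsilon _ _ _ _); apply/funext => i /=.
- by rewrite fE.
- by rewrite fE univ_eval_X /interleave odd_double doubleK.
- by rewrite fE univ_eval_X /interleave /= odd_double /= uphalf_double.
Qed.

Lemma comrng_axioms_inj (T I : Type) (R : comPzRingType) (o : rngops T)
    (phi : T -> I -> R) :
  (forall x y, phi x =1 phi y -> x = y) ->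
  (forall x y i, [/\ phi (radd o x y) i = phi x i + phi y i,
                     phi (rmul o x y) i = phi x i * phi y i,
                     phi (rzero o) i = 0 & phi (ropp o x) i = - phi x i]) ->
  comrng_axioms o.
Proof.
move=> inj morph.
have D x y i : phi (radd o x y) i = phi x i + phi y i by have [] := morph x y i.
have M x y i : phi (rmul o x y) i = phi x i * phi y i by have [] := morph x y i.
have Z i : phi (rzero o) i = 0 by have [] := morph (rzero o) (rzero o) i.
have N x i : phi (ropp o x) i = - phi x i by have [] := morph x x i.
do !split=> *; apply: inj => i; rewrite !(D, M, Z, N).
- exact: addrA.
- exact: addrC.
- exact: add0r.
- exact: addNr.
- exact: mulrA.
- exact: mulrC.
- exact: mulrDl.
Qed.

(** Zero and opposite are included, because carrying the ring axioms from the free algebra to A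
    requires them to commute with morphisms too. *)
Definition rng_natural (F : lamfun) :=
  forall (A B : comPzRingType) (qA : A) (qB : B) (f : {rmorphism A -> B}),
  f qA = qB -> forall x y : nat -> A,
  [/\ f \o radd (F A qA) x y = radd (F B qB) (f \o x) (f \o y),
      f \o rmul (F A qA) x y = rmul (F B qB) (f \o x) (f \o y),
      f \o rzero (F A qA) = rzero (F B qB) &
      f \o ropp (F A qA) x = ropp (F B qB) (f \o x)].

Definition ghost_morphism (g : {poly int}) (F : lamfun) :=
  forall (A : comPzRingType) (q : A) (x y : nat -> A) k,
  [/\ Upsilon g q (radd (F A q) x y) k = Upsilon g q x k + Upsilon g q y k,
      Upsilon g q (rmul (F A q) x y) k = Upsilon g q x k * Upsilon g q y k,
      Upsilon g q (rzero (F A q)) k = 0 &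
      Upsilon g q (ropp (F A q) x) k = - Upsilon g q x k].

(* The ring axioms hold over the free algebra because the ghost map is
   injective there; naturality carries them to every quotient. *)
Lemma natural_ghost_is_lambda_bar (g : {poly int}) (F : lamfun) : g != 1 ->
  rng_natural F -> ghost_morphism g F -> is_lambda_bar g F.
Proof.
move=> g1 natF ups; split; last split.
- move=> A q; pose U := F univ univ_q.
  have ax : comrng_axioms U.
    apply: (@comrng_axioms_inj _ _ _ _ (Upsilon g univ_q)) => [x y|x y k].
      exact: univ_Upsilon_inj.
    exact: ups.
  have [aA [aC [a0 [aN [mA [mC mD]]]]]] := ax.
  have lift x y z : exists f : {rmorphism univ -> A}, exists x' y' z' : nat -> univ,
      [/\ x = f \o x', y = f \o y', z = f \o z' &
      [/\ forall u v, radd (F A q) (f \o u) (f \o v) = f \o radd U u v,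
          forall u v, rmul (F A q) (f \o u) (f \o v) = f \o rmul U u v,
          rzero (F A q) = f \o rzero U &
          forall u, ropp (F A q) (f \o u) = f \o ropp U u]].
    have [f [x' [y' [z' [fq -> -> ->]]]]] := univ_lift q x y z.
    exists f, x', y', z'; split=> //; have natf := natF _ _ _ _ f fq.
    split=> [u v|u v||u].
    - by have [<-] := natf u v.
    - by have [_ <-] := natf u v.
    - by have [_ _ <-] := natf x' x'.
    - by have [_ _ _ <-] := natf u u.
  split; last split; last split; last split; last split; last split.
  + move=> x y z; have [f [x' [y' [z' [-> -> -> [fD _ _ _]]]]]] := lift x y z.
    by rewrite !fD aA.
  + move=> x y; have [f [x' [y' [_ [-> -> _ [fD _ _ _]]]]]] := lift x y y.
    by rewrite !fD aC.
  + move=> x; have [f [x' [_ [_ [-> _ _ [fD _ f0 _]]]]]] := lift x x x.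
    by rewrite f0 fD a0.
  + move=> x; have [f [x' [_ [_ [-> _ _ [fD _ f0 fN]]]]]] := lift x x x.
    by rewrite f0 fN fD aN.
  + move=> x y z; have [f [x' [y' [z' [-> -> -> [_ fM _ _]]]]]] := lift x y z.
    by rewrite !fM mA.
  + move=> x y; have [f [x' [y' [_ [-> -> _ [_ fM _ _]]]]]] := lift x y y.
    by rewrite !fM mC.
  + move=> x y z; have [f [x' [y' [z' [-> -> -> [fD fM _ _]]]]]] := lift x y z.
    by rewrite !(fD, fM) mD.
- by move=> A B qA qB f fq x y; have [] := natF _ _ _ _ f fq x y.
- by move=> A q x y k; have [] := ups _ q x y k.
Qed.

(** As q differs from 1, injectivity over the free algebra is available here; the exceptional g = 1
    is reached later by letting q act as 1. *)
Lemma is_lambda_bar_X : exists F, is_lambda_bar 'X F.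
Proof.
have [sa saE] := Upsilon_add 'X univ_q univ_x univ_y.
have [sm smE] := Upsilon_mul 'X univ_q univ_x univ_y.
have [sn snE] := Upsilon_opp 'X univ_q univ_x.
have [sz szE] := Upsilon_zero 'X univ_q.
(* Zero and opposite are encoded as binary operations as well; their surplus arguments are filled by
   a rule that commutes with morphisms. *)
exists (fun A q => RngOps (univ_op sa q) (univ_op sm q)
  (univ_op sz q (fun=> 0) (fun=> 0)) (fun x => univ_op sn q x x)).
apply: natural_ghost_is_lambda_bar.
- by apply/eqP => /(congr1 (fun p : {poly int} => size p)); rewrite size_polyX size_poly1.
- move=> A B qA _ f <- x y; split; [exact: univ_op_map|exact: univ_op_map| |exact: univ_op_map].
  by apply: etrans (univ_op_map _ _ _ _ _) _; congr (univ_op _ _ _ _);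
    apply/funext => i; exact: rmorph0.
- move=> A q x y k; split.
  + by have [f [fE -> ->]] := Upsilon_univ_op sa q x y; rewrite -rmorphD -saE; exact: fE.
  + by have [f [fE -> ->]] := Upsilon_univ_op sm q x y; rewrite -rmorphM -smE; exact: fE.
  + have [f [fE _ _]] := Upsilon_univ_op sz q (fun=> 0) (fun=> 0).
    by apply: etrans (fE k) _; rewrite szE rmorph0.
  + by have [f [fE -> _]] := Upsilon_univ_op sn q x x; rewrite -rmorphN -snE; exact: fE.
Qed.

Lemma Upsilon_gval (A : comPzRingType) (g : {poly int}) (q : A) x k :
  Upsilon g q x k = Upsilon 'X (gval g q) x k.
Proof. by rewrite !Upsilon_ghost gvalX. Qed.

(** A morphism that preserves q also preserves g(q), so functoriality survives the change of
    structure. *)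
Lemma is_lambda_bar_gval (g : {poly int}) (F : lamfun) :
  is_lambda_bar 'X F -> is_lambda_bar g (fun A q => F A (gval g q)).
Proof.
move=> [ax [natF ups]]; split; last split.
- by move=> A q; exact: ax.
- by move=> A B qA qB f <- x y; apply: natF; rewrite gval_map.
- by move=> A q x y k; have gE z := Upsilon_gval g q z k; rewrite !gE; exact: ups.
Qed.

Theorem theorem4p1 (g : {poly int}) :
  (exists F : lamfun, is_lambda_bar g F) /\
  (g != 1 ->
   forall F1 F2 : lamfun, is_lambda_bar g F1 -> is_lambda_bar g F2 ->
   forall (A : comPzRingType) (qA : A) (x y : nat -> A),
     radd (F1 A qA) x y = radd (F2 A qA) x y /\
     rmul (F1 A qA) x y = rmul (F2 A qA) x y /\
     rzero (F1 A qA) = rzero (F2 A qA) /\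
     ropp (F1 A qA) x = ropp (F2 A qA) x).
Proof.
split; last by move=> g1 F1 F2; exact: is_lambda_bar_unique.
have [F FX] := is_lambda_bar_X.
by exists (fun A q => F A (gval g q)); exact: is_lambda_bar_gval.
Qed.
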